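(* Let $R_1>0$ and consider the metric $ds^{2}=-dt^{2}+[dr-\beta(r)\,dt]^{2}+r^{2}d\Omega^{2}$ with source components $\rho$ and $p_\perp=-\rho-\tfrac r2\rho'$. If $\rho\in C^1([R_1,b])$ for some $b>R_1$, then $$\mathcal B(R_1,b)\equiv 2\int_{R_1}^{b}\frac{\rho+p_\perp}{r}\,dr=\rho(R_1)-\rho(b).$$ In particular, if $\rho(R_1)=0$ and $\rho(b)>0$, then $\mathcal B(R_1,b)=-\rho(b)<0$ and $$\min_{r\in[R_1,b]}(\rho+p_\perp)\le-\frac{\rho(b)}{2\ln(b/R_1)}.$$
   Context: Geometric units $G=c=1$. The metric class is the unit-lapse, flat-slice radial Painlevé–Gullstrand class $ds^{2}=-dt^{2}+[dr-\beta(r)dt]^{2}+r^{2}d\Omega^{2}$. The source is $T_{\mu\nu}=G_{\mu\nu}/(8\pi)$; in the orthonormal frame of the Eulerian normal $n^\mu=(1,\beta,0,0)$ it is diagonal, with energy density $\rho$, radial pressure $p_r$, and tangential pressure $p_\perp$. With $w=r\beta^2$ these are $8\pi\rho=w'/r^2$, $p_r=-\rho$, $p_\perp=-w''/(16\pi r)=-\rho-\frac r2\rho'$. *)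

(* Defs.v *)
From Stdlib Require Import Reals.
From Coquelicot Require Import Coquelicot.
Open Scope R_scope.

Inductive coord : Set := ct | cr | cth | cph.

Definition coord_eqb (i j : coord) : bool :=
  match i, j with
  | ct, ct | cr, cr | cth, cth | cph, cph => true
  | _, _ => false
  end.

Definition event := coord -> R.

Definition upd (x : event) (i : coord) (s : R) : event :=
  fun j => if coord_eqb i j then s else x j.

Definition csum (f : coord -> R) : R := f ct + f cr + f cth + f cph.

Definition pd (i : coord) (F : event -> R) (x : event) : R :=
  Derive (fun s => F (upd x i s)) (x i).

Definition tensor2 := coord -> coord -> event -> R.

(* Curvature of a metric g_{ij} with inverse gi^{ij}, with the sign conventions
     R^k_{lij} = d_i Gamma^k_{jl} - d_j Gamma^k_{il} + ...,
     Ric_{ij} = R^k_{ikj},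
   so that round spheres have positive Ricci curvature. *)
Definition christoffel (g gi : tensor2) (k i j : coord) (x : event) : R :=
  / 2 * csum (fun l =>
    gi k l x * (pd i (g l j) x + pd j (g l i) x - pd l (g i j) x)).

Definition riemann (g gi : tensor2) (k l i j : coord) (x : event) : R :=
  pd i (christoffel g gi k j l) x - pd j (christoffel g gi k i l) x
  + csum (fun m =>
      christoffel g gi k i m x * christoffel g gi m j l x
      - christoffel g gi k j m x * christoffel g gi m i l x).

Definition ricci (g gi : tensor2) (i j : coord) (x : event) : R :=
  csum (fun k => riemann g gi k i k j x).

Definition scalar_curvature (g gi : tensor2) (x : event) : R :=
  csum (fun i => csum (fun j => gi i j x * ricci g gi i j x)).

Definition einstein (g gi : tensor2) : tensor2 := fun i j x =>
  ricci g gi i j x - / 2 * scalar_curvature g gi x * g i j x.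

Definition stress_energy (g gi : tensor2) : tensor2 := fun i j x =>
  einstein g gi i j x / (8 * PI).

(* ds^2 = -dt^2 + (dr - beta(r) dt)^2 + r^2 (dth^2 + sin^2 th dph^2),
   expanded in the coordinates (t, r, th, ph). *)
Definition pg_metric (beta : R -> R) : tensor2 := fun i j x =>
  match i, j with
  | ct, ct => - 1 + beta (x cr) ^ 2
  | ct, cr | cr, ct => - beta (x cr)
  | cr, cr => 1
  | cth, cth => x cr ^ 2
  | cph, cph => x cr ^ 2 * sin (x cth) ^ 2
  | _, _ => 0
  end.

Definition pg_inverse (beta : R -> R) : tensor2 := fun i j x =>
  match i, j with
  | ct, ct => - 1
  | ct, cr | cr, ct => - beta (x cr)
  | cr, cr => 1 - beta (x cr) ^ 2
  | cth, cth => / x cr ^ 2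
  | cph, cph => / (x cr ^ 2 * sin (x cth) ^ 2)
  | _, _ => 0
  end.

Lemma pg_inverseP (beta : R -> R) (x : event) (i j : coord) :
  x cr <> 0 -> sin (x cth) <> 0 ->
  csum (fun k => pg_metric beta i k x * pg_inverse beta k j x)
  = if coord_eqb i j then 1 else 0.
Proof.
intros hr hs; destruct i, j; unfold csum; simpl; field; auto.
Qed.

Definition pg_T (beta : R -> R) : tensor2 :=
  stress_energy (pg_metric beta) (pg_inverse beta).

Definition apply2 (T : tensor2) (u v : coord -> event -> R) (x : event) : R :=
  csum (fun i => csum (fun j => T i j x * u i x * v j x)).

Definition eulerian_normal (beta : R -> R) : coord -> event -> R := fun i x =>
  match i with ct => 1 | cr => beta (x cr) | _ => 0 end.

Definition e_th : coord -> event -> R := fun i x =>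
  match i with cth => / x cr | _ => 0 end.

Definition e_ph : coord -> event -> R := fun i x =>
  match i with cph => / (x cr * sin (x cth)) | _ => 0 end.

(* The events over a < r < b, off the coordinate axis sin th = 0. *)
Definition in_shell (a b : R) (x : event) : Prop :=
  a < x cr < b /\ 0 < x cth < PI.

(* The endpoints are left out because the Einstein tensor uses two-sided
   derivatives; there the profiles are fixed by continuity. *)
Definition is_energy_density (beta : R -> R) (a b : R) (rho : R -> R) : Prop :=
  forall x : event, in_shell a b x ->
    apply2 (pg_T beta) (eulerian_normal beta) (eulerian_normal beta) x
    = rho (x cr).

Definition is_tangential_pressure (beta : R -> R) (a b : R) (p : R -> R) : Prop :=
  forall x : event, in_shell a b x ->
    apply2 (pg_T beta) e_th e_th x = p (x cr) /\
    apply2 (pg_T beta) e_ph e_ph x = p (x cr).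

Definition twice_derivable (beta : R -> R) (a b : R) : Prop :=
  forall r, a < r < b -> ex_derive beta r /\ ex_derive (Derive beta) r.

(* f is C^1 on the closed interval [a, b] with derivative f', which is one-sided
   at a and b; the values of f outside [a, b] are irrelevant. *)
Definition is_C1_on (a b : R) (f f' : R -> R) : Prop :=
  (forall x, a <= x <= b ->
     filterlim (fun y => (f y - f x) / (y - x))
       (within (fun y => a <= y <= b) (locally' x)) (locally (f' x))) /\
  continuous_on (fun y => a <= y <= b) f'.

Definition p_perp (rho rho' : R -> R) (r : R) : R :=
  - rho r - r / 2 * rho' r.

Definition nec_budget (rho p : R -> R) (a b : R) : R :=
  2 * RInt (fun r => (rho r + p r) / r) a b.

Definition is_min_on (a b : R) (f : R -> R) (m : R) : Prop :=
  (exists r, a <= r <= b /\ f r = m) /\ (forall r, a <= r <= b -> m <= f r).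

(* Main.v *)
(* With w = r beta^2, the Ricci tensor of the metric is w'' / (2 r) times the
   metric on the (t, r) block and w' / r^2 times the metric on the (th, ph) block.
   Hence 8 pi rho = w' / r^2 and p_perp = - w'' / (16 pi r) = - rho - r rho' / 2,
   so that (rho + p_perp) / r = - rho' / 2 and the budget telescopes. The bound
   on the minimum m follows from (rho + p_perp) / r >= m / r by integration. *)

Require Import Defs.
From Stdlib Require Import Reals Lra.
From Coquelicot Require Import Coquelicot.
Open Scope R_scope.

(** * Locality of partial derivatives on the shell *)

Lemma in_shell_locally (a b : R) (x : event) (i : coord) :
  in_shell a b x -> locally (x i) (fun s => in_shell a b (upd x i s)).
Proof.
intros [[h1 h2] [h3 h4]]; unfold in_shell, upd.
destruct i; simpl.
- apply filter_forall; intros s; repeat split; assumption.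
- apply filter_imp with (fun s => a < s /\ s < b); [tauto|].
  apply filter_and; [now apply open_gt | now apply open_lt].
- apply filter_imp with (fun s => 0 < s /\ s < PI); [tauto|].
  apply filter_and; [now apply open_gt | now apply open_lt].
- apply filter_forall; intros s; repeat split; assumption.
Qed.

(** The shell is open along each coordinate line, and a partial derivative sees only nearby values
    on such a line. Closed forms valid only on the shell can thus be differentiated there. *)
Lemma pd_ext_shell (a b : R) (F G : event -> R) (x : event) (i : coord) :
  (forall y, in_shell a b y -> F y = G y) -> in_shell a b x ->
  pd i F x = pd i G x.
Proof.
intros hFG hx; apply Derive_ext_loc.
refine (filter_imp _ _ _ (in_shell_locally a b x i hx)).
intros s; apply hFG.
Qed.

(** * The Levi-Civita connection in closed form *)

Definition d_pg_metric (beta : R -> R) (k i j : coord) (x : event) : R :=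
  match k, i, j with
  | cr, ct, ct => 2 * beta (x cr) * Derive beta (x cr)
  | cr, ct, cr | cr, cr, ct => - Derive beta (x cr)
  | cr, cth, cth => 2 * x cr
  | cr, cph, cph => 2 * x cr * sin (x cth) ^ 2
  | cth, cph, cph => 2 * x cr ^ 2 * sin (x cth) * cos (x cth)
  | _, _, _ => 0
  end.

Lemma pd_pg_metric (beta : R -> R) (k i j : coord) (x : event) :
  ex_derive beta (x cr) ->
  pd k (pg_metric beta i j) x = d_pg_metric beta k i j x.
Proof.
intros hb.
destruct k, i, j; unfold pd, upd; simpl; apply is_derive_unique;
  auto_derive; try tauto;
  (* [auto_derive] may leave [beta] eta-expanded; folding it makes [Derive beta] a single atom for
     [ring]. *)
  change (fun y => beta y) with beta; ring.
Qed.

(** The first index is the upper one. *)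
Definition pg_christoffel (beta : R -> R) (k i j : coord) (x : event) : R :=
  let r := x cr in
  let B := beta r in
  let dB := Derive beta r in
  let s := sin (x cth) in
  match k, i, j with
  | ct, ct, ct => B ^ 2 * dB
  | ct, ct, cr | ct, cr, ct => - (B * dB)
  | ct, cr, cr => dB
  | ct, cth, cth => r * B
  | ct, cph, cph => r * B * s ^ 2
  | cr, ct, ct => (B ^ 2 - 1) * B * dB
  | cr, ct, cr | cr, cr, ct => - (B ^ 2 * dB)
  | cr, cr, cr => B * dB
  | cr, cth, cth => (B ^ 2 - 1) * r
  | cr, cph, cph => (B ^ 2 - 1) * r * s ^ 2
  | cth, cr, cth | cth, cth, cr | cph, cr, cph | cph, cph, cr => / r
  | cth, cph, cph => - (s * cos (x cth))
  | cph, cth, cph | cph, cph, cth => cos (x cth) / s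
  | _, _, _ => 0
  end.

Lemma christoffel_pg (beta : R -> R) (k i j : coord) (x : event) :
  ex_derive beta (x cr) -> x cr <> 0 -> sin (x cth) <> 0 ->
  christoffel (pg_metric beta) (pg_inverse beta) k i j x
  = pg_christoffel beta k i j x.
Proof.
intros hb hr hs; unfold christoffel, csum.
rewrite !pd_pg_metric by assumption.
destruct k, i, j; simpl; field; auto.
Qed.

(* The derivative of cot is written - 1 - cot^2, not - / sin^2, so that the
   curvature identities hold without using sin^2 + cos^2 = 1. *)
Definition d_pg_christoffel (beta : R -> R) (l k i j : coord) (x : event) : R :=
  let r := x cr in
  let B := beta r in
  let dB := Derive beta r in
  let ddB := Derive (Derive beta) r in
  let s := sin (x cth) in
  let c := cos (x cth) in
  match l, k, i, j with
  | cr, ct, ct, ct => 2 * B * dB ^ 2 + B ^ 2 * ddB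
  | cr, ct, ct, cr | cr, ct, cr, ct => - (dB ^ 2 + B * ddB)
  | cr, ct, cr, cr => ddB
  | cr, ct, cth, cth => B + r * dB
  | cr, ct, cph, cph => (B + r * dB) * s ^ 2
  | cr, cr, ct, ct => (3 * B ^ 2 - 1) * dB ^ 2 + (B ^ 2 - 1) * B * ddB
  | cr, cr, ct, cr | cr, cr, cr, ct => - (2 * B * dB ^ 2 + B ^ 2 * ddB)
  | cr, cr, cr, cr => dB ^ 2 + B * ddB
  | cr, cr, cth, cth => 2 * B * dB * r + (B ^ 2 - 1)
  | cr, cr, cph, cph => (2 * B * dB * r + (B ^ 2 - 1)) * s ^ 2
  | cr, cth, cr, cth | cr, cth, cth, cr
  | cr, cph, cr, cph | cr, cph, cph, cr => - / r ^ 2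
  | cth, ct, cph, cph => 2 * r * B * s * c
  | cth, cr, cph, cph => 2 * (B ^ 2 - 1) * r * s * c
  | cth, cth, cph, cph => s ^ 2 - c ^ 2
  | cth, cph, cth, cph | cth, cph, cph, cth => - 1 - (c / s) ^ 2
  | _, _, _, _ => 0
  end.

Lemma pd_pg_christoffel (beta : R -> R) (l k i j : coord) (x : event) :
  ex_derive beta (x cr) -> ex_derive (Derive beta) (x cr) ->
  x cr <> 0 -> sin (x cth) <> 0 ->
  pd l (pg_christoffel beta k i j) x = d_pg_christoffel beta l k i j x.
Proof.
intros hb hb2 hr hs.
destruct l, k, i, j; unfold pd, upd; simpl; apply is_derive_unique;
  auto_derive; try tauto;
  change (fun y => beta y) with beta;
  change (fun y => Derive beta y) with (Derive beta); field; auto.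
Qed.

(** * Riemann, Ricci and scalar curvature *)

(** Collects the side conditions of the closed forms: [0 <= a < x cr] excludes the centre, and
    [0 < x cth < PI] excludes the axis. *)
Lemma shell_regular (beta : R -> R) (a b : R) (x : event) :
  0 <= a -> twice_derivable beta a b -> in_shell a b x ->
  ex_derive beta (x cr) /\ ex_derive (Derive beta) (x cr) /\
  x cr <> 0 /\ sin (x cth) <> 0.
Proof.
intros ha hbeta [hr [h0 hpi]]; destruct (hbeta _ hr) as [h1 h2].
repeat split; auto; [lra|].
apply Rgt_not_eq, sin_gt_0; assumption.
Qed.

Lemma riemann_pg (beta : R -> R) (a b : R) (k l i j : coord) (x : event) :
  0 <= a -> twice_derivable beta a b -> in_shell a b x ->
  riemann (pg_metric beta) (pg_inverse beta) k l i j x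
  = d_pg_christoffel beta i k j l x - d_pg_christoffel beta j k i l x
    + csum (fun m =>
        pg_christoffel beta k i m x * pg_christoffel beta m j l x
        - pg_christoffel beta k j m x * pg_christoffel beta m i l x).
Proof.
intros ha hbeta hx.
(* Stated on the whole shell and not only at [x], because [hD] differentiates this identity. *)
assert (hC : forall k i j y, in_shell a b y ->
  christoffel (pg_metric beta) (pg_inverse beta) k i j y
  = pg_christoffel beta k i j y).
{ intros k' i' j' y hy.
  destruct (shell_regular beta a b y ha hbeta hy) as (? & ? & ? & ?).
  now apply christoffel_pg. }
assert (hD : forall l k i j,
  pd l (christoffel (pg_metric beta) (pg_inverse beta) k i j) x
  = d_pg_christoffel beta l k i j x).
{ intros l' k' i' j'.
  destruct (shell_regular beta a b x ha hbeta hx) as (? & ? & ? & ?).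
  rewrite (pd_ext_shell a b _ _ x l' (hC k' i' j') hx).
  now apply pd_pg_christoffel. }
unfold riemann, csum.
now rewrite !hD, !hC.
Qed.

(* The derivatives of the paper's w = r beta^2. *)
Definition pg_w' (beta : R -> R) (r : R) : R :=
  beta r ^ 2 + 2 * r * beta r * Derive beta r.

Definition pg_w'' (beta : R -> R) (r : R) : R :=
  4 * beta r * Derive beta r
  + 2 * r * (Derive beta r ^ 2 + beta r * Derive (Derive beta) r).

Lemma is_derive_pg_w' (beta : R -> R) (r : R) :
  ex_derive beta r -> ex_derive (Derive beta) r ->
  is_derive (pg_w' beta) r (pg_w'' beta r).
Proof.
intros h1 h2; unfold pg_w', pg_w''.
auto_derive; [tauto|].
change (fun y => beta y) with beta.
change (fun y => Derive beta y) with (Derive beta); ring.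
Qed.

(** After substitution of the closed forms, each of the sixteen components is a rational identity in
    [r], [beta], its first two derivatives, and the sine and cosine of the polar angle. *)
Lemma ricci_pg (beta : R -> R) (a b : R) (i j : coord) (x : event) :
  0 <= a -> twice_derivable beta a b -> in_shell a b x ->
  ricci (pg_metric beta) (pg_inverse beta) i j x
  = match i with
    | ct | cr => pg_w'' beta (x cr) / (2 * x cr)
    | cth | cph => pg_w' beta (x cr) / x cr ^ 2
    end * pg_metric beta i j x.
Proof.
intros ha hbeta hx.
destruct (shell_regular beta a b x ha hbeta hx) as (_ & _ & hr & hs).
unfold ricci, csum at 1; rewrite !(riemann_pg beta a b) by assumption.
unfold csum, pg_w', pg_w''.
destruct i, j; simpl; field; auto.
Qed.

(** Each block is two-dimensional, so its Ricci factor counts twice in the trace. *)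
Lemma scalar_curvature_pg (beta : R -> R) (a b : R) (x : event) :
  0 <= a -> twice_derivable beta a b -> in_shell a b x ->
  scalar_curvature (pg_metric beta) (pg_inverse beta) x
  = pg_w'' beta (x cr) / x cr + 2 * pg_w' beta (x cr) / x cr ^ 2.
Proof.
intros ha hbeta hx.
destruct (shell_regular beta a b x ha hbeta hx) as (_ & _ & hr & hs).
unfold scalar_curvature, csum; rewrite !(ricci_pg beta a b) by assumption.
simpl; field; auto.
Qed.

(** * Frame components of the source *)

(** The normal is a unit timelike vector in the (t, r) block, so the [w''] terms of the Ricci tensor
    and of the scalar curvature cancel. *)
Lemma energy_density_pg (beta : R -> R) (a b : R) (x : event) :
  0 <= a -> twice_derivable beta a b -> in_shell a b x ->
  apply2 (pg_T beta) (eulerian_normal beta) (eulerian_normal beta) x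
  = pg_w' beta (x cr) / (8 * PI * x cr ^ 2).
Proof.
intros ha hbeta hx.
destruct (shell_regular beta a b x ha hbeta hx) as (_ & _ & hr & hs).
unfold apply2, csum, pg_T, stress_energy, einstein.
rewrite !(ricci_pg beta a b), !(scalar_curvature_pg beta a b) by assumption.
simpl; field; split; [exact hr | exact PI_neq0].
Qed.

(** Both vectors are unit vectors in the angular block, where it is the [w'] terms that cancel. *)
Lemma tangential_pressure_pg (beta : R -> R) (a b : R) (x : event) :
  0 <= a -> twice_derivable beta a b -> in_shell a b x ->
  apply2 (pg_T beta) e_th e_th x = - pg_w'' beta (x cr) / (16 * PI * x cr) /\
  apply2 (pg_T beta) e_ph e_ph x = - pg_w'' beta (x cr) / (16 * PI * x cr).
Proof.
intros ha hbeta hx.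
destruct (shell_regular beta a b x ha hbeta hx) as (_ & _ & hr & hs).
assert (hpi := PI_neq0).
unfold apply2, csum, pg_T, stress_energy, einstein.
rewrite !(ricci_pg beta a b), !(scalar_curvature_pg beta a b) by assumption.
split; simpl; field; auto.
Qed.

(** * Calculus on a closed interval with one-sided derivatives *)

(** A small ball around an interior point lies in [[a, b]], so the restriction of the limit to the
    interval disappears. *)
Lemma is_C1_on_is_derive (a b : R) (f f' : R -> R) (x : R) :
  is_C1_on a b f f' -> a < x < b -> is_derive f x (f' x).
Proof.
intros [hf _] hx.
apply is_derive_Reals; intros eps heps.
assert (hn : locally x (fun y => a <= y <= b)).
{ apply filter_imp with (fun y => a < y /\ y < b); [intros y; lra|].
  apply filter_and; [apply open_gt | apply open_lt]; apply hx. }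
assert (hq := hf x (conj (Rlt_le _ _ (proj1 hx)) (Rlt_le _ _ (proj2 hx)))).
assert (he : locally (f' x) (fun z => Rabs (z - f' x) < eps)).
{ exists (mkposreal eps heps); intros z hz; exact hz. }
destruct hn as [d1 h1]; destruct (hq _ he) as [d2 h2].
assert (hd : 0 < Rmin d1 d2) by (apply Rmin_pos; apply cond_pos).
exists (mkposreal _ hd); intros h h0 hh; simpl in hh.
assert (hball : forall d : posreal, Rmin d1 d2 <= d -> ball x d (x + h)).
{ intros d hd'; change (Rabs (x + h - x) < d).
  replace (x + h - x) with h by ring; lra. }
specialize (h2 (x + h) (hball d2 (Rmin_r _ _))).
replace (x + h - x) with h in h2 by ring.
apply h2; [lra | apply h1, hball, Rmin_l].
Qed.

(** Near [x] the difference quotient stays within 1 of [f' x], which bounds the increment of [f] by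
    [M] times that of the argument, also at the endpoints. *)
Lemma is_C1_on_continuous_on (a b : R) (f f' : R -> R) :
  is_C1_on a b f f' -> continuous_on (fun y => a <= y <= b) f.
Proof.
intros [hf _] x hx P [eps hP].
assert (he : locally (f' x) (fun z => Rabs (z - f' x) < 1)).
{ exists (mkposreal 1 Rlt_0_1); intros z hz; exact hz. }
destruct (hf x hx _ he) as [d2 h2].
set (M := Rabs (f' x) + 1).
assert (hM : 0 < M) by (assert (h := Rabs_pos (f' x)); unfold M; lra).
assert (hd : 0 < Rmin d2 (eps / M)).
{ apply Rmin_pos; [apply cond_pos|].
  apply Rdiv_lt_0_compat; [apply cond_pos | exact hM]. }
exists (mkposreal _ hd); intros y hy hyD; apply hP.
(* The quotient is controlled only on a punctured neighbourhood, so [y = x] is treated apart. *)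
destruct (Req_dec y x) as [-> | hne]; [apply ball_center|].
change (Rabs (y - x) < Rmin d2 (eps / M)) in hy.
change (Rabs (f y - f x) < eps).
assert (hq : Rabs ((f y - f x) / (y - x) - f' x) < 1).
{ apply h2; [|exact hne|exact hyD].
  apply Rlt_le_trans with (1 := hy), Rmin_l. }
assert (hqM : Rabs ((f y - f x) / (y - x)) <= M).
{ unfold M; split_Rabs; lra. }
replace (f y - f x) with ((f y - f x) / (y - x) * (y - x)) by (field; lra).
rewrite Rabs_mult.
apply Rle_lt_trans with (M * Rabs (y - x)).
- apply Rmult_le_compat_r; [apply Rabs_pos | exact hqM].
- apply Rlt_le_trans with (M * (eps / M)).
  + apply Rmult_lt_compat_l; [exact hM|].
    apply Rlt_le_trans with (1 := hy), Rmin_r.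
  + right; field; lra.
Qed.

(** The nearest-point retraction onto [[a, b]]. Composing with it extends a function by its endpoint
    values, turning one-sided continuity into continuity on the line. *)
Definition clamp (a b x : R) : R := Rmax a (Rmin b x).

Lemma clamp_in (a b x : R) : a <= b -> a <= clamp a b x <= b.
Proof.
intros hab; unfold clamp; split; [apply Rmax_l|].
apply Rmax_lub; [assumption | apply Rmin_l].
Qed.

Lemma clamp_id (a b x : R) : a <= x <= b -> clamp a b x = x.
Proof.
intros hx; unfold clamp; rewrite Rmin_right, Rmax_right; lra.
Qed.

Lemma clamp_contract (a b x y : R) :
  Rabs (clamp a b y - clamp a b x) <= Rabs (y - x).
Proof.
unfold clamp, Rmax, Rmin; repeat destruct Rle_dec; split_Rabs; lra.
Qed.

(** Clamping does not increase distances, so the radius that serves [f] at the clamped point also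
    serves the composition. *)
Lemma continuous_clamp (a b : R) (f : R -> R) (x : R) : a <= b ->
  continuous_on (fun y => a <= y <= b) f ->
  continuous (fun y => f (clamp a b y)) x.
Proof.
intros hab hf P hP.
destruct (hf (clamp a b x) (clamp_in a b x hab) P hP) as [d hd].
exists d; intros y hy; apply hd; [|now apply clamp_in].
apply Rle_lt_trans with (2 := hy); apply clamp_contract.
Qed.

(* [is_RInt_derive] requires two-sided derivatives at the endpoints; here only
   the one-sided ones exist, so the mean value theorem is applied to
   the difference between f and a primitive of the clamped derivative. *)
Lemma is_RInt_is_C1_on (a b : R) (f f' : R -> R) : a < b ->
  is_C1_on a b f f' -> is_RInt f' a b (f b - f a).
Proof.
intros hab hf.
set (g := fun x => f' (clamp a b x)).
assert (hg : forall x, continuous g x).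
{ intros x; apply continuous_clamp; [lra | apply hf]. }
assert (hint : forall u v, ex_RInt g u v).
{ intros u v; apply (ex_RInt_continuous (V := R_CompleteNormedModule)); auto. }
assert (hF : forall x, is_derive (fun y => RInt g a y) x (g x)).
{ intros x; apply (is_derive_RInt g (fun y => RInt g a y) a x).
  - apply filter_forall; intros y.
    apply (RInt_correct (V := R_CompleteNormedModule)), hint.
  - apply hg. }
set (h := fun x => f (clamp a b x) - RInt g a x).
destruct (MVT_gen h a b (fun _ => 0)) as [c [_ hc]].
- rewrite Rmin_left, Rmax_right by lra; intros x hx.
  replace 0 with (f' x - g x)
    by (unfold g; rewrite clamp_id by lra; ring).
  apply (is_derive_minus (V := R_NormedModule)); [|apply hF].
  apply is_derive_ext_loc with f; [|now apply (is_C1_on_is_derive a b)].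
  apply filter_imp with (fun y => a < y /\ y < b).
  + intros y hy; rewrite clamp_id; [reflexivity | lra].
  + apply filter_and; [apply open_gt | apply open_lt]; apply hx.
- intros x _; apply continuity_pt_filterlim.
  apply (continuous_minus (V := R_NormedModule)).
  + apply continuous_clamp; [lra|].
    now apply is_C1_on_continuous_on with f'.
  + apply (ex_derive_continuous (V := R_NormedModule)).
    exists (g x); apply hF.
(* The mean value theorem with derivative 0 gives [h b = h a], and the integral from [a] to [a]
   vanishes. *)
- unfold h in hc; rewrite !clamp_id, RInt_point in hc by lra.
  change (zero (G := R_CompleteNormedModule)) with 0 in hc.
  replace (f b - f a) with (RInt g a b) by lra.
  apply is_RInt_ext with g.
  + rewrite Rmin_left, Rmax_right by lra; intros x hx.
    unfold g; rewrite clamp_id by lra; reflexivity.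
  + apply (RInt_correct (V := R_CompleteNormedModule)), hint.
Qed.

(** The extreme value theorem is applied to the clamped function, which is continuous on both sides
    of the endpoints. *)
Lemma continuous_on_attains_min (a b : R) (f : R -> R) : a <= b ->
  continuous_on (fun y => a <= y <= b) f -> exists m, is_min_on a b f m.
Proof.
intros hab hf.
destruct (continuity_ab_min (fun x => f (clamp a b x)) a b hab) as [c [hmin hc]].
- intros x _; apply continuity_pt_filterlim.
  now apply continuous_clamp.
- exists (f c); split; [now exists c|].
  intros r hr; specialize (hmin r hr); cbv beta in hmin.
  now rewrite !clamp_id in hmin.
Qed.

Lemma is_RInt_inv (a b : R) : 0 < a -> a <= b -> is_RInt Rinv a b (ln (b / a)).
Proof.
intros ha hab.
rewrite ln_div by lra.
apply (is_RInt_derive (V := R_CompleteNormedModule) ln Rinv);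
  rewrite Rmin_left, Rmax_right by lra; intros x hx.
- apply is_derive_Reals, derivable_pt_lim_ln; lra.
- apply continuity_pt_filterlim, continuity_pt_inv; [|lra].
  apply derivable_continuous_pt, derivable_pt_id.
Qed.

(** * The tangential pressure and the budget *)

Lemma p_perp_tangential (beta rho rho' : R -> R) (a b : R) :
  0 <= a -> twice_derivable beta a b -> is_energy_density beta a b rho ->
  is_C1_on a b rho rho' -> is_tangential_pressure beta a b (p_perp rho rho').
Proof.
intros ha hbeta hrho hC1 x hx.
assert (hrhoE : forall r, a < r < b ->
  rho r = pg_w' beta r / (8 * PI * r ^ 2)).
{ intros r hr.
  (* Every radius in the open interval is realised by an event with the angles of [x]. *)
  set (y := upd x cr r).
  assert (hy : in_shell a b y) by (split; [exact hr | apply hx]).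
  change (rho r) with (rho (y cr)); rewrite <- (hrho y hy).
  now rewrite (energy_density_pg beta a b). }
destruct (shell_regular beta a b x ha hbeta hx) as (h1 & h2 & hr & _).
assert (hpi := PI_neq0).
assert (hx' := proj1 hx).
set (r := x cr) in *.
(* Uniqueness of the derivative identifies [rho'] with the derivative of the closed form of
   [rho]. *)
assert (hd : rho' r = pg_w'' beta r / (8 * PI * r ^ 2)
                      - 2 * pg_w' beta r / (8 * PI * r ^ 3)).
{ assert (hw := is_derive_pg_w' beta r h1 h2).
  rewrite <- (is_derive_unique _ _ _ (is_C1_on_is_derive a b _ _ r hC1 hx')).
  apply is_derive_unique.
  apply is_derive_ext_loc with (fun r => pg_w' beta r / (8 * PI * r ^ 2)).
  - apply filter_imp with (fun y => a < y /\ y < b).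
    + intros y hy; symmetry; now apply hrhoE.
    + apply filter_and; [apply open_gt | apply open_lt]; apply hx'.
  - auto_derive.
    + split; [eexists; exact hw|].
      split; [|exact I].
      simpl; repeat (apply Rmult_integral_contrapositive_currified; auto); lra.
    + change (fun y => pg_w' beta y) with (pg_w' beta).
      rewrite (is_derive_unique _ _ _ hw); field; auto. }
assert (hp : p_perp rho rho' r = - pg_w'' beta r / (16 * PI * r)).
(* The [w'] part of [- r / 2 * rho'] cancels [- rho]. *)
{ unfold p_perp; rewrite hd, hrhoE by exact hx'; field; auto. }
rewrite hp; now apply (tangential_pressure_pg beta a b).
Qed.

Theorem proposition2 (R1 b : R) (beta rho rho' : R -> R)
    (hR1 : 0 < R1) (hb : R1 < b)
    (hbeta : twice_derivable beta R1 b)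
    (hrho : is_energy_density beta R1 b rho)
    (hC1 : is_C1_on R1 b rho rho') :
  is_tangential_pressure beta R1 b (p_perp rho rho') /\
  ex_RInt (fun r => (rho r + p_perp rho rho' r) / r) R1 b /\
  nec_budget rho (p_perp rho rho') R1 b = rho R1 - rho b /\
  (rho R1 = 0 -> 0 < rho b ->
     nec_budget rho (p_perp rho rho') R1 b = - rho b /\
     - rho b < 0 /\
     exists m : R,
       is_min_on R1 b (fun r => rho r + p_perp rho rho' r) m /\
       m <= - (rho b / (2 * ln (b / R1)))).
Proof.
assert (hI : is_RInt (fun r => (rho r + p_perp rho rho' r) / r) R1 b
               (- / 2 * (rho b - rho R1))).
{ apply is_RInt_ext with (fun r => - / 2 * rho' r).
  - rewrite Rmin_left, Rmax_right by lra; intros r hr.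
    (* The equality is typed in the carrier of a normed module; recasting it in [R] lets [field]
       apply. *)
    match goal with |- ?u = ?v => change (@eq R u v) end.
    unfold p_perp; field; lra.
  - apply (is_RInt_scal (V := R_NormedModule)); now apply is_RInt_is_C1_on. }
assert (hB : nec_budget rho (p_perp rho rho') R1 b = rho R1 - rho b).
{ unfold nec_budget; rewrite (is_RInt_unique _ _ _ _ hI); field. }
split; [apply p_perp_tangential; auto; lra|].
split; [eexists; exact hI|].
split; [exact hB|].
intros h0 hpos; split; [lra|]; split; [lra|].
(* This form shows that the function is continuous on the closed interval, as a product of [- r / 2]
   and the continuous [rho']; hence its minimum is attained. *)
assert (hE : forall r, - / 2 * r * rho' r = rho r + p_perp rho rho' r).
{ intros r; unfold p_perp; field. }
destruct (continuous_on_attains_min R1 b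
  (fun r => rho r + p_perp rho rho' r)) as [m hm]; [lra| |].
- apply continuous_on_ext with (fun r => - / 2 * r * rho' r).
  + intros r _; apply hE.
  + intros r hr.
    apply (filterlim_comp_2 (F := within _ (locally r))
      (fun r => - / 2 * r) rho' Rmult
      (G := locally (- / 2 * r)) (H := locally (rho' r))).
    * eapply filterlim_filter_le_1; [apply filter_le_within|].
      apply (filterlim_scal_r (V := R_NormedModule)).
    * apply (proj2 hC1 r hr).
    * apply (filterlim_mult (K := R_AbsRing)).
- exists m; split; [exact hm|].
  assert (hln : 0 < ln (b / R1)).
  { rewrite <- ln_1; apply ln_increasing; [lra|].
    apply Rmult_lt_reg_r with R1; [lra|]; field_simplify; lra. }
  assert (hle : m * ln (b / R1) <= - / 2 * (rho b - rho R1)).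
  { apply (is_RInt_le (fun r => m * / r)
      (fun r => (rho r + p_perp rho rho' r) / r) R1 b); [lra| |exact hI|].
    - apply (is_RInt_scal (V := R_NormedModule)), is_RInt_inv; lra.
    - intros r hr; apply Rmult_le_compat_r.
      + left; apply Rinv_0_lt_compat; lra.
      + apply (proj2 hm); lra. }
  (* Clearing the positive logarithm turns the bound into [hle] with [rho R1 = 0]. *)
  apply Rmult_le_reg_r with (ln (b / R1)); [exact hln|].
  replace (- (rho b / (2 * ln (b / R1))) * ln (b / R1)) with (- / 2 * rho b)
    by (field; lra).
  rewrite h0 in hle; lra.
Qed.
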